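(* Let $G$ be a finite simple graph that is the complement of a bipartite graph, with clique number $\omega=\omega(G)$. Then $\varphi(G)\leq \frac{4\omega}{3}$. Furthermore, for a positive integer $b$, $G$ admits a $b$-coloring with $b$ colors if and only if $G\in\mathcal{A}_b$.
   Context: A $b$-coloring of $G$ with $b$ colors is a proper coloring of $V(G)$ using exactly $b$ colors such that for every color $i$ there is a vertex of color $i$ having neighbors of all the other $b-1$ colors. The $b$-chromatic number $\varphi(G)$ is the largest $b$ for which such a coloring exists. $\omega(G)$ is the largest order of a complete subgraph. An antimatching between disjoint vertex sets $S,T$ of $G$ is a matching between $S$ and $T$ in the complement $\overline{G}$; it is perfect if it covers all of $S\cup T$ (so $|S|=|T|$ and each vertex of $S$ is paired with a distinct non-neighbor in $T$). The family $\mathcal{A}_b$ consists of all graphs $G$ that are complements of bipartite graphs for which there is a partition $V(G)=X\cup Y$ with $X$ and $Y$ each inducing a clique in $G$, together with partitions $X=A_1\cup B_1\cup C_1$ and $Y=A_2\cup B_2\cup C_2$ (parts possibly empty) such that: (1) every vertex of $A_1$ is adjacent to every vertex of $A_2\cup B_2$, and every vertex of $A_2$ is adjacent to every vertex of $C_1$; (2) $|B_1|=|B_2|$ and there is a perfect antimatching between $B_1$ and $B_2$; (3) $|C_1|=|C_2|$ and there is a perfect antimatching between $C_1$ and $C_2$; and $b=|A_1|+|A_2|+|B_1|+|C_1|=|X|+|A_2|$. *)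

(* Defs.v *)
From mathcomp Require Import all_boot all_order all_algebra.

Set Implicit Arguments.
Unset Strict Implicit.
Unset Printing Implicit Defensive.

(* A finite simple graph is a finite type T of vertices with an adjacency
   relation e : rel T that is symmetric and irreflexive.  Symmetry and
   irreflexivity are hypotheses of the theorem, not part of the definitions. *)

Definition compl_graph (T : finType) (e : rel T) : rel T :=
  [rel x y | (x != y) && ~~ e x y].

(* The two sides are X and its complement; either one may be empty. *)
Definition bipartite (T : finType) (e : rel T) : Prop :=
  exists X : {set T}, forall x y : T, e x y -> (x \in X) != (y \in X).

Definition cobipartite (T : finType) (e : rel T) : Prop :=
  bipartite (compl_graph e).

Definition clique (T : finType) (e : rel T) (K : {set T}) : bool :=
  [forall x in K, forall y in K, (x != y) ==> e x y].

Definition omega (T : finType) (e : rel T) : nat :=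
  \max_(K : {set T} | clique e K) #|K|.

Definition proper_coloring (T : finType) (e : rel T) (b : nat)
    (c : {ffun T -> 'I_b}) : bool :=
  [forall x, forall y, e x y ==> (c x != c y)].

Definition b_coloring (T : finType) (e : rel T) (b : nat)
    (c : {ffun T -> 'I_b}) : bool :=
  [&& proper_coloring e c,
      [forall i : 'I_b, exists x, c x == i] &
      [forall i : 'I_b, exists x, (c x == i) &&
        [forall j : 'I_b, (j != i) ==> [exists y, e x y && (c y == j)]]]].

Definition b_colorable (T : finType) (e : rel T) (b : nat) : bool :=
  [exists c : {ffun T -> 'I_b}, b_coloring e c].

(* Only b <= #|T| need be considered, by b_colorable_leq below. *)
Definition b_chromatic (T : finType) (e : rel T) : nat :=
  \max_(b < #|T|.+1 | b_colorable e b) b.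

Lemma b_colorable_leq (T : finType) (e : rel T) (b : nat) :
  b_colorable e b -> b <= #|T|.
Proof.
case/existsP=> c /and3P[_ /forallP surj _].
rewrite -[b in b <= _]card_ord -(size_codom c); apply: leq_trans (card_size _).
apply/subset_leq_card/subsetP=> i _.
by have /existsP[x /eqP <-] := surj i; apply: codom_f.
Qed.

Lemma b_chromatic_geq (T : finType) (e : rel T) (b : nat) :
  b_colorable e b -> b <= b_chromatic e.
Proof.
move=> bcol; have lt_b : b < #|T|.+1 by rewrite ltnS (b_colorable_leq bcol).
exact: (@leq_bigmax_cond _ (fun i : 'I_#|T|.+1 => b_colorable e i)
          (fun i => nat_of_ord i) (Ordinal lt_b)).
Qed.

(* Edges are encoded as two-element vertex sets, so that trivIset M says that
   distinct edges of M share no vertex. *)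
Definition matching_between (T : finType) (e : rel T) (S R : {set T})
    (M : {set {set T}}) : Prop :=
  (forall E, E \in M ->
     exists x y, [/\ x \in S, y \in R, e x y & E = [set x; y]])
  /\ trivIset M.

Definition antimatching_between (T : finType) (e : rel T) (S R : {set T})
    (M : {set {set T}}) : Prop :=
  matching_between (compl_graph e) S R M.

Definition has_perfect_antimatching (T : finType) (e : rel T)
    (S R : {set T}) : Prop :=
  exists2 M : {set {set T}}, antimatching_between e S R M & cover M = S :|: R.

Definition all_adjacent (T : finType) (e : rel T) (S R : {set T}) : Prop :=
  forall x y, x \in S -> y \in R -> e x y.

(* The library's [partition] requires nonempty blocks; here empty parts are
   allowed. *)
Definition split2 (T : finType) (D X Y : {set T}) : Prop :=
  D = X :|: Y /\ [disjoint X & Y].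

Definition split3 (T : finType) (X A B C : {set T}) : Prop :=
  [/\ X = A :|: B :|: C, [disjoint A & B], [disjoint A & C]
    & [disjoint B & C]].

Definition family_A (T : finType) (b : nat) (e : rel T) : Prop :=
  cobipartite e /\
  exists X Y A1 B1 C1 A2 B2 C2 : {set T},
    [/\ [/\ split2 [set: T] X Y, clique e X & clique e Y],
        split3 X A1 B1 C1 /\ split3 Y A2 B2 C2,
        all_adjacent e A1 (A2 :|: B2) /\ all_adjacent e A2 C1,
        (#|B1| = #|B2| /\ has_perfect_antimatching e B1 B2) /\
        (#|C1| = #|C2| /\ has_perfect_antimatching e C1 C2)
      & b = #|A1| + #|A2| + #|B1| + #|C1| /\ b = #|X| + #|A2|].

(* Main.v *)
Require Import Defs.
From mathcomp Require Import all_boot all_order all_algebra.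
From mathcomp Require Import zify lra.

(** Let [V(G)] be the union of two disjoint cliques [X] and [Y].  A color class
    of a proper coloring is a single vertex of [X] (these form [A1]), a single
    vertex of [Y] ([A2]), or a nonadjacent pair meeting both cliques.  A vertex
    of [X] sees every color that occurs in [X], so it is a b-vertex iff it is
    adjacent to all of [A2]; symmetrically for [Y] and [A1].  Putting a pair in
    [B] when its vertex in [Y] is a b-vertex, and in [C] otherwise, gives the
    structure of [family_A], and conversely.  For the bound, [X], [Y],
    [A1 + A2 + B2] and [A1 + A2 + C1] are cliques whose sizes add up to [3 b]. *)

Section Cobipartite.

Variables (T : finType) (e : rel T).
Hypotheses (e_sym : symmetric e) (e_irr : irreflexive e).
Implicit Types (X Y S R A B C : {set T}) (b : nat).

(** * Cliques and the clique number *)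

Lemma cliqueP X :
  reflect {in X &, forall x y, x != y -> e x y} (clique e X).
Proof.
apply: (iffP forall_inP) => [eX x y xX yX | eX x xX].
  by apply/implyP; move/(_ x xX)/forall_inP: eX; apply.
by apply/forall_inP=> y yX; apply/implyP; apply: eX.
Qed.

Lemma cliqueU S R :
  clique e S -> clique e R -> all_adjacent e S R -> clique e (S :|: R).
Proof.
move=> /cliqueP eS /cliqueP eR eSR; apply/cliqueP=> x y.
case/setUP=> [xS|xR] /setUP[yS|yR] nxy; first exact: eS.
- exact: eSR.
- by rewrite e_sym; apply: eSR.
exact: eR.
Qed.

Lemma cliqueS S R : S \subset R -> clique e R -> clique e S.
Proof.
move=> /subsetP sSR /cliqueP eR; apply/cliqueP=> x y xS yS.
by apply: eR; apply: sSR.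
Qed.

Lemma clique_omega X : clique e X -> #|X| <= omega e.
Proof. exact: (@leq_bigmax_cond _ _ (fun K : {set T} => #|K|)). Qed.

Lemma cobipartite_cliques :
  cobipartite e -> exists2 X, clique e X & clique e (~: X).
Proof.
case=> X bipX; exists X; apply/cliqueP=> x y; rewrite ?inE => xX yX nxy;
  apply: contraT => nexy; have := bipX x y; rewrite /compl_graph /= nxy nexy.
  by rewrite xX yX => /(_ isT).
by rewrite (negPf xX) (negPf yX) => /(_ isT).
Qed.

Lemma card_split3 X A B C : split3 X A B C -> #|X| = #|A| + #|B| + #|C|.
Proof.
case=> -> dAB dAC dBC; rewrite !cardsU (disjoint_setI0 dAB) cards0 subn0.
by rewrite setIUl (disjoint_setI0 dAC) (disjoint_setI0 dBC) setU0 cards0 subn0.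
Qed.

(** * Perfect antimatchings as functions *)

(** A perfect antimatching in functional form: [m] sends each vertex of [R] to its partner in [S];
    its values outside [R] are arbitrary. *)
Definition antimate S R (m : T -> T) : Prop :=
  [/\ {in R &, injective m}, m @: R = S & {in R, forall y, ~~ e (m y) y}].

Lemma antimate_perfect S R m : [disjoint S & R] -> antimate S R m ->
  has_perfect_antimatching e S R.
Proof.
move=> dSR [m_inj mRS m_nadj]; exists [set [set m y; y] | y in R].
  have mS y : y \in R -> m y \in S by rewrite -mRS; apply: imset_f.
  have neq y z : y \in R -> z \in R -> m y != z.
    move=> yR zR; apply: contraTneq zR => <-.
    by rewrite (disjointFr dSR) ?mS.
  split=> [_ /imsetP[y yR ->]|].
    by exists (m y), y; split; rewrite ?mS // /compl_graph /= neq ?m_nadj.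
  apply/trivIsetP=> _ _ /imsetP[y yR ->] /imsetP[z zR ->] nyz.
  have {}nyz : y != z by apply: contraNneq nyz => ->.
  rewrite -setI_eq0; apply/eqP/setP=> t; rewrite !inE.
  apply/negbTE/andP=> -[/orP[]/eqP-> /orP[]/eqP].
  - by move/m_inj=> /(_ yR zR)/eqP; apply/negP.
  - by apply/eqP; apply: neq.
  - by apply/eqP; rewrite eq_sym; apply: neq.
  by apply/eqP.
rewrite cover_imset -mRS; apply/setP=> t; apply/bigcupP/setUP.
  by case=> y yR /set2P[]->; [left; apply: imset_f | right].
by case=> [/imsetP[y yR ->]|tR]; [exists y | exists t]; rewrite // !inE eqxx ?orbT.
Qed.

(** The partner of [y] is read off an edge of [M] that covers [y]. Disjointness of the edges makes
    this choice injective, and equality of the cardinals then makes it onto [S]. *)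
Lemma perfect_antimate S R : [disjoint S & R] -> #|S| = #|R| ->
  has_perfect_antimatching e S R -> exists m, antimate S R m.
Proof.
move=> dSR cSR [M [M_edge M_triv] M_cov].
pose p y x := (x \in S) && ([set x; y] \in M).
have pP y : y \in R -> exists x, p y x.
  move=> yR; have : y \in cover M by rewrite M_cov inE yR orbT.
  case/bigcupP=> E EM yE; have [x [z [xS zR _ defE]]] := M_edge E EM.
  exists x; rewrite /p xS; move: yE; rewrite defE => /set2P[eyx|->].
    by rewrite eyx (disjointFr dSR xS) in yR.
  by rewrite -defE.
(* The default [y] is never reached for [y] in [R], by [pP]. *)
pose m y := odflt y [pick x | p y x].
have mP y : y \in R -> p y (m y).
  by move=> yR; rewrite /m; case: pickP => // p0; have [x] := pP y yR; rewrite p0.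
have neq y z : y \in R -> z \in R -> m y <> z.
  by move=> yR zR myz; have /andP[] := mP y yR; rewrite myz (disjointFl dSR zR).
have m_inj : {in R &, injective m}.
  move=> y z yR zR myz; have /andP[_ yM] := mP y yR; have /andP[_ zM] := mP z zR.
  (* Both edges of [M] contain [m y], so they cannot be disjoint. *)
  have eyz : [set m y; y] = [set m z; z].
    apply/eqP/(contraT (b := _ == _)) => /(trivIsetP M_triv _ _ yM zM).
    by move/disjoint_setI0/setP/(_ (m y)); rewrite !inE myz eqxx.
  have : y \in [set m z; z] by rewrite -eyz !inE eqxx orbT.
  by case/set2P=> // /esym /(neq z y zR yR).
exists m; split=> // [|y yR].
  apply/eqP; rewrite eqEcard card_in_imset // cSR leqnn andbT.
  by apply/subsetP=> _ /imsetP[y yR ->]; case/andP: (mP y yR).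
(* Edges are unordered sets, so the endpoints must be identified: since [S] and [R] are disjoint,
   [x] is [m y] and [z] is [y]. *)
have /andP[_ /M_edge[x [z [xS zR /andP[_ nexz] /setP eE]]]] := mP y yR.
have := eE x; rewrite !inE eqxx => /orP[/eqP ex | /eqP ex]; last first.
  by rewrite ex (disjointFl dSR yR) in xS.
have := eE z; rewrite !inE eqxx orbT => /orP[/eqP ez | /eqP ez].
  by case: (neq y z).
by rewrite -ex -ez.
Qed.

(** Merges the antimatchings of the [B] and [C] parts into one map, so that the coloring treats all
    matched vertices alike. *)
Lemma antimateU S1 R1 S2 R2 m1 m2 :
  [disjoint S1 & S2] -> [disjoint R1 & R2] ->
  antimate S1 R1 m1 -> antimate S2 R2 m2 ->
  antimate (S1 :|: S2) (R1 :|: R2) (fun y => if y \in R1 then m1 y else m2 y).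
Proof.
move=> dS dR [inj1 im1 n1] [inj2 im2 n2].
have R2F y : y \in R2 -> (y \in R1) = false by apply: disjointFl.
have nS y z : y \in R1 -> z \in R2 -> m1 y <> m2 z.
  move=> yR zR emyz; have : m2 z \in S1 by rewrite -emyz -im1 imset_f.
  by rewrite (disjointFl dS) // -im2 imset_f.
split.
- move=> y z /setUP[yR|yR] /setUP[zR|zR]; rewrite ?yR ?zR ?R2F //.
  + exact: inj1.
  + by move/nS=> /(_ yR zR).
  + by move/esym/nS=> /(_ zR yR).
  exact: inj2.
- rewrite imsetU -im1 -im2; congr (_ :|: _); apply: eq_in_imset => y yR.
    by rewrite yR.
  by rewrite R2F.
by move=> y /setUP[yR|yR]; rewrite ?yR ?R2F //; [apply: n1 | apply: n2].
Qed.

(** * From the structure to a coloring *)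

(** Allows vertices to serve as colors: ranking the elements of [D] turns them into ordinals. *)
Lemma b_colorable_image (U : finType) (D : {set U}) (f : T -> U) :
    (forall v, f v \in D) -> (forall u v, e u v -> f u != f v) ->
    {in D, forall i, exists2 v, f v = i &
      {in D, forall j, j != i -> exists2 w, e v w & f w = j}} ->
  b_colorable e #|D|.
Proof.
move=> fD f_proper f_dom; pose c := [ffun v => enum_rank_in (fD v) (f v)].
have cE v : enum_val (c v) = f v by rewrite ffunE enum_rankK_in.
have cP v i : (c v == i) = (f v == enum_val i).
  by rewrite -cE (inj_eq enum_val_inj).
apply/existsP; exists c; apply/and3P; split.
- apply/forallP=> u; apply/forallP=> v; apply/implyP=> /f_proper.
  by rewrite cP cE.
- apply/forallP=> i; have [v fv _] := f_dom _ (enum_valP i).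
  by apply/existsP; exists v; rewrite cP fv.
apply/forallP=> i; have [v fv v_dom] := f_dom _ (enum_valP i).
apply/existsP; exists v; rewrite cP fv eqxx; apply/forallP=> j; apply/implyP=> nji.
have [|w evw fw] := v_dom _ (enum_valP j); first by rewrite (inj_eq enum_val_inj).
by apply/existsP; exists w; rewrite evw cP fw eqxx.
Qed.

(** The colors are the vertices of [X :|: A2]. Each of these is its own color, and a vertex of
    [B2 :|: C2] takes the color of its partner in [X]. *)
Lemma family_A_b_colorable b : family_A b e -> b_colorable e b.
Proof.
case=> _ [X [Y [A1 [B1 [C1 [A2 [B2 [C2 []]]]]]]]].
case=> [[XY dXY] /cliqueP eX /cliqueP eY].
case=> [[defX dAB1 dAC1 dBC1] [defY dAB2 dAC2 dBC2]] [eA1 eA2].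
case=> [[cB mateB] [cC mateC]] [_ ->].
have sX x : x \in A1 :|: B1 :|: C1 -> x \in X by rewrite defX.
have sY y : y \in A2 :|: B2 :|: C2 -> y \in Y by rewrite defY.
have dSR S R : S \subset X -> R \subset Y -> [disjoint S & R].
  by move=> sSX sRY; apply: disjointWl sSX (disjointWr sRY dXY).
have [mB mBP] : exists m, antimate B1 B2 m.
  by apply: perfect_antimate => //; apply: dSR;
    apply/subsetP=> z zB; [apply: sX | apply: sY]; rewrite !inE zB !orbT.
have [mC mCP] : exists m, antimate C1 C2 m.
  by apply: perfect_antimate => //; apply: dSR;
    apply/subsetP=> z zC; [apply: sX | apply: sY]; rewrite !inE zC !orbT.
have := antimateU _ _ _ _ _ _ dBC1 dBC2 mBP mCP.
set m := fun y => _; case=> m_inj im_m m_nadj.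
have sA2 y : y \in A2 -> y \in Y by move=> yA; apply: sY; rewrite !inE yA.
have sR y : y \in B2 :|: C2 -> y \in Y.
  by move=> yR; apply: sY; rewrite -setUA inE yR orbT.
have mX y : y \in B2 :|: C2 -> m y \in X.
  by move=> yR; apply: sX; rewrite -setUA inE -im_m imset_f ?orbT.
pose f v := if v \in B2 :|: C2 then m v else v.
have fX x : x \in X -> f x = x.
  by move=> xX; rewrite /f ifN //; apply: contraL xX => /sR /(disjointFl dXY)->.
have fA2 y : y \in A2 -> f y = y.
  move=> yA; rewrite /f ifN // inE negb_or.
  by rewrite (disjointFr dAB2 yA) (disjointFr dAC2 yA).
have f_surj j : j \in B1 :|: C1 -> exists2 w, w \in Y & f w = j.
  rewrite -im_m => /imsetP[w wR ->]; exists w; first exact: sR.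
  by rewrite /f wR.
have domX v : v \in X -> {in A2, forall a, e v a} ->
    {in X :|: A2, forall j, j != v -> exists2 w, e v w & f w = j}.
  move=> vX evA j /setUP[jX|jA] nj; exists j; [|exact: fX | exact: evA | exact: fA2].
  by apply: eX => //; rewrite eq_sym.
(* Inside its own clique a vertex of [Y] sees every other color outside [A1], because the colors in
   [B1 :|: C1] also occur on [B2 :|: C2]. *)
have domY v : v \in Y -> {in A1, forall a, e v a} ->
    {in X :|: A2, forall j, j != f v -> exists2 w, e v w & f w = j}.
  move=> vY evA j /setUP[jX|jA] nj; last first.
    exists j; last exact: fA2; apply: eY => //; first exact: sA2.
    by apply: contraNneq nj => ->; rewrite fA2.
  move: jX; rewrite defX -setUA => /setUP[jA|jS]; last first.
    have [w wY fw] := f_surj j jS; exists w => //; apply: eY => //.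
    by apply: contraNneq nj => ->; rewrite fw.
  by exists j; [apply: evA | rewrite fX // sX // !inE jA].
rewrite -cardsUI (_ : X :&: A2 = set0) ?cards0 ?addn0; last first.
  by apply: disjoint_setI0; apply: dSR => //; apply/subsetP.
apply: (@b_colorable_image _ _ f).
- move=> v; rewrite /f; case: ifPn => [vR|vR]; first by rewrite inE mX.
  have : v \in X :|: Y by rewrite -XY inE.
  by rewrite defY -setUA setUA inE (negPf vR) orbF.
- move=> u v euv; rewrite /f; case: ifPn => uR; case: ifPn => vR.
  + by apply/eqP=> /m_inj euv'; rewrite euv' // e_irr in euv.
  + by apply: contraTneq euv => <-; rewrite e_sym m_nadj.
  + by apply: contraTneq euv => ->; rewrite m_nadj.
  by apply: contraTneq euv => ->; rewrite e_irr.
(* A color in [A1], [C1] or [A2] has itself as b-vertex. For a color in [B1] the b-vertex is its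
   partner in [B2], which is adjacent to all of [A1]. *)
move=> i /setUP[|iA]; first rewrite {1}defX => /setUP[/setUP[iA|iB]|iC].
- have iX : i \in X by apply: sX; rewrite !inE iA.
  exists i; first exact: fX.
  by apply: domX => // a aA; apply: eA1; rewrite // inE aA.
- have [_ imB _] := mBP; move: iB; rewrite -imB => /imsetP[y yB ->].
  have fy : f y = mB y by rewrite /f /m inE yB.
  exists y => //; rewrite -fy; apply: domY => [|a aA].
    by apply: sR; rewrite inE yB.
  by rewrite e_sym; apply: eA1; rewrite // inE yB orbT.
- have iX : i \in X by apply: sX; rewrite !inE iC orbT.
  exists i; first exact: fX.
  by apply: domX => // a aA; rewrite e_sym; apply: eA2.
exists i => [|j jD nji]; first exact: fA2.
apply: domY => //; [exact: sA2 | move=> a aA | by rewrite fA2].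
by rewrite e_sym; apply: eA1; rewrite // inE iA.
Qed.

(** * From a coloring to the structure *)

Lemma b_colorable_family_A b : cobipartite e -> b_colorable e b -> family_A b e.
Proof.
move=> cobip /existsP[c bc]; split=> //.
have [X eX eY] := cobipartite_cliques cobip; set Y := ~: X in eY.
case/and3P: bc => c_proper c_surj c_dom.
have c_nadj u v : c u = c v -> ~~ e u v.
  move=> cuv; apply/negP=> euv; have /forallP/(_ u)/forallP/(_ v) := c_proper.
  by rewrite euv cuv eqxx.
have c_inj K : clique e K -> {in K &, injective c}.
  move=> /cliqueP eK u v uK vK cuv; apply/eqP.
  by apply: contraT => /(eK u v uK vK); rewrite (negPf (c_nadj u v cuv)).
have cX := c_inj X eX; have cY := c_inj Y eY.
have inY v : v \in Y = (v \notin X) by rewrite inE.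
(* These are the vertices whose color occurs on one side only; as [c] is injective on each clique,
   each is alone in its color class. *)
pose A1 := [set x in X | c x \notin c @: Y].
pose A2 := [set y in Y | c y \notin c @: X].
have A1uniq a v : a \in A1 -> c v = c a -> v = a.
  rewrite inE => /andP[aX aY] cva; apply: cX => //.
  by apply: contraR aY; rewrite -inY -cva; apply: imset_f.
have A2uniq a v : a \in A2 -> c v = c a -> v = a.
  rewrite inE => /andP[aY aX] cva; apply: cY => //; rewrite inY.
  by apply: contra aX; rewrite -cva; apply: imset_f.
pose dom v := forall j, j != c v -> exists2 w, e v w & c w = j.
have domP i : exists2 v, c v = i & dom v.
  have /forallP/(_ i)/existsP[v /andP[/eqP cv /forallP v_dom]] := c_dom.
  exists v => // j; rewrite cv => nj.
  have /implyP/(_ nj)/existsP[w /andP[evw /eqP cw]] := v_dom j.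
  by exists w.
(* A b-vertex [v] has a neighbor of color [c a], and [a] is the only vertex of that color. *)
have domA v a : a \in A1 :|: A2 -> dom v -> c a != c v -> e v a.
  move=> aA v_dom nav; have [w evw cw] := v_dom _ nav.
  suff <- : w = a by [].
  by case/setUP: aA => aA; [apply: A1uniq | apply: A2uniq].
(* With this choice [B2] is completely joined to [A1] by definition; b-vertices are needed only for
   the pairs [A1], [A2] and [A2], [C1]. *)
pose B2 := [set y in Y :\: A2 | [forall a in A1, e a y]].
pose C2 := Y :\: A2 :\: B2.
(* The partner of [y] is the vertex of [X] in its color class. The default is never reached on
   [Y :\: A2]. *)
pose m y := odflt y [pick x in X | c x == c y].
have mP y : y \in Y :\: A2 -> m y \in X /\ c (m y) = c y.
  rewrite !inE => /andP[+ yY]; rewrite yY negbK => /imsetP[x xX cyx].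
  rewrite /m; case: pickP => [z /andP[zX /eqP cz] // | /(_ x)].
  by rewrite xX cyx eqxx.
have m_inj : {in Y :\: A2 &, injective m}.
  move=> y z yD zD myz; have [_ cy] := mP y yD; have [_ cz] := mP z zD.
  by apply: cY; [case/setDP: yD | case/setDP: zD | rewrite -cy -cz myz].
have sB : B2 \subset Y :\: A2 by apply/subsetP=> y; rewrite !inE => /andP[].
have sC : C2 \subset Y :\: A2 by apply: subsetDl.
have defD : B2 :|: C2 = Y :\: A2.
  by rewrite /C2 -{2}(setID (Y :\: A2) B2) (setIidPr sB).
have dBC2 : [disjoint B2 & C2]
  by apply/pred0P=> y /=; rewrite /C2 in_setD; case: (y \in B2).
have mate R : R \subset Y :\: A2 ->
    #|m @: R| = #|R| /\ has_perfect_antimatching e (m @: R) R.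
  move=> /subsetP sR.
  have injR : {in R &, injective m} by move=> y z /sR yD /sR zD; apply: m_inj.
  split; first exact: card_in_imset.
  apply: (antimate_perfect _ _ m).
    apply/pred0P=> y /=; apply/andP=> -[/imsetP[z /sR zD ->] /sR/setDP[]].
    by have [zX _] := mP z zD; rewrite inY zX.
  by split=> // y /sR yD; apply: c_nadj; case: (mP y yD).
have defX : X = A1 :|: m @: B2 :|: m @: C2.
  rewrite -setUA -imsetU defD; apply/setP=> x; apply/idP/setUP; last first.
    by case=> [|/imsetP[y yD ->]]; [rewrite inE => /andP[] | case: (mP y yD)].
  move=> xX; rewrite inE xX; have [cx|] := boolP (c x \in c @: Y); last by left.
  have /imsetP[y yY cxy] := cx; right; apply/imsetP; exists y.
    by rewrite !inE -cxy imset_f //= -inY yY.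
  have [|myX cy] := mP y; first by rewrite !inE -cxy imset_f //= -inY yY.
  by apply: cX; rewrite // cy.
have dA1 R : R \subset Y :\: A2 -> [disjoint A1 & m @: R].
  move=> /subsetP sR; apply/pred0P=> x /=; apply/andP=> -[+ /imsetP[y /sR yD ex]].
  rewrite inE ex => /andP[_ /negP[]]; have [_ ->] := mP y yD.
  by apply: imset_f; case/setDP: yD.
have dBC1 : [disjoint m @: B2 & m @: C2].
  apply/pred0P=> x /=; apply/andP; case=> /imsetP[y yB ->] /imsetP[z zC myz].
  have eyz : y = z by apply: m_inj => //; [apply: (subsetP sB) | apply: (subsetP sC)].
  by rewrite -eyz (disjointFr dBC2 yB) in zC.
have dA2 R : R \subset Y :\: A2 -> [disjoint A2 & R].
  move=> /subsetP sR; apply/pred0P=> x /=; apply/andP=> -[xA /sR].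
  by rewrite inE xA.
(* The map [c] is injective on [X] and on [A2], with disjoint images, and a color missing from [X]
   occurs on [A2]. *)
have cardb : b = #|X| + #|A2|.
  rewrite -(card_in_imset cX) -(@card_in_imset _ _ c A2); last first.
    by move=> y z yA zA; apply: A2uniq.
  rewrite -cardsUI (_ : c @: X :&: c @: A2 = set0) ?cards0 ?addn0; last first.
    apply/setP=> i; rewrite !inE; apply/negP=> /andP[/[swap] /imsetP[a aA ->]].
    by move: aA; rewrite !inE => /andP[_ /negPf->].
  rewrite (_ : _ :|: _ = setT) ?cardsT ?card_ord //; apply/setP=> i.
  have /forallP/(_ i)/existsP[v /eqP <-] := c_surj; rewrite !inE.
  have [//|/negPf vX /=] := boolP (c v \in c @: X).
  apply: imset_f; rewrite inE vX andbT inY.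
  by apply: contraFN vX; apply: imset_f.
exists X, Y, A1, (m @: B2), (m @: C2), A2, B2, C2; split.
- split=> //; split; first by rewrite setUCr.
  by rewrite -setI_eq0 setICr.
- split; split=> //; try by [apply: dA1 | apply: dA2].
  rewrite -setUA defD -{1}(setID Y A2); congr (_ :|: _); apply/setIidPr.
  by apply/subsetP=> y; rewrite inE => /andP[].
- split=> [a y aA /setUP[yA|] | y x yA /imsetP[z zC ->]]; last first.
  + have [|mzX cmz] := mP z; first exact: (subsetP sC).
    have zY : z \in Y by case/setDP: zC => /setDP[].
    (* The class of [z] is the pair of [z] and [m z]. If its b-vertex were [z], then [z] would be
       adjacent to all of [A1] and lie in [B2]; so it is [m z], which therefore sees all of [A2]. *)
    rewrite e_sym; have [v cv v_dom] := domP (c z).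
    have [vX|vX] := boolP (v \in X).
      have <- : v = m z by apply: cX; rewrite // cmz.
      apply: domA => //; first by rewrite inE yA orbT.
      by apply: contraTneq yA => cyv; rewrite !inE cyv imset_f // andbF.
    have evz : v = z by apply: cY => //; rewrite inY.
    case/setDP: zC => zD; rewrite inE zD /= => /negP[].
    apply/forall_inP=> a aA; rewrite e_sym -evz; apply: domA => //.
      by rewrite inE aA.
    by apply: contraTneq aA => cav; rewrite inE cav cv imset_f // andbF.
  + by rewrite inE => /andP[_ /forall_inP]; apply.
  (* The vertex [a] is alone in its class, hence is the b-vertex of its color. *)
  have [v cv v_dom] := domP (c a); have <- := A1uniq a v aA cv.
  apply: domA => //; first by rewrite inE yA orbT.
  move: yA; rewrite inE => /andP[_]; apply: contraNneq => ->.
  by rewrite cv; apply: imset_f; move: aA; rewrite inE => /andP[].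
- by split; apply: mate.
have cX3 : #|X| = #|A1| + #|m @: B2| + #|m @: C2|.
  by apply: card_split3; split=> //; apply: dA1.
by split=> //; rewrite cardb cX3; lia.
Qed.

(** * The bound by the clique number *)

Lemma family_A_omega b : family_A b e -> 3 * b <= 4 * omega e.
Proof.
case=> _ [X [Y [A1 [B1 [C1 [A2 [B2 [C2 []]]]]]]]].
case=> [[_ dXY] eX eY] [splitX splitY] [eA1 eA2] [[cB _] [cC _]] [bE _].
have [defX _ _ _] := splitX; have [defY dAB2 _ _] := splitY.
have sX S : S \subset A1 :|: B1 :|: C1 -> S \subset X by rewrite defX.
have sY S : S \subset A2 :|: B2 :|: C2 -> S \subset Y by rewrite defY.
have sA1 : A1 \subset X by apply: sX; rewrite -setUA subsetUl.
have sC1 : C1 \subset X by apply: sX; rewrite subsetUr.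
have sA2 : A2 \subset Y by apply: sY; rewrite -setUA subsetUl.
have sAB2 : A2 :|: B2 \subset Y by apply: sY; rewrite subsetUl.
have dA1 : [disjoint A1 & A2 :|: B2].
  exact: disjointWl sA1 (disjointWr sAB2 dXY).
have sAC1 : A1 :|: C1 \subset X by rewrite subUset sA1 sC1.
have dA2 : [disjoint A1 :|: C1 & A2].
  exact: disjointWl sAC1 (disjointWr sA2 dXY).
have dAC1 : [disjoint A1 & C1] by case: splitX.
have cardU S R : [disjoint S & R] -> #|S :|: R| = #|S| + #|R|.
  by move=> /disjoint_setI0 dSR; rewrite cardsU dSR cards0 subn0.
have := clique_omega _ eX; have := clique_omega _ eY.
have /clique_omega : clique e (A1 :|: (A2 :|: B2)).
  by apply: cliqueU eA1; [apply: cliqueS eX | apply: cliqueS eY].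
have /clique_omega : clique e (A1 :|: C1 :|: A2).
  apply: cliqueU; [exact: cliqueS eX | exact: cliqueS eY |].
  move=> x y /setUP[xA|xC] yA; first by apply: eA1; rewrite // inE yA.
  by rewrite e_sym; apply: eA2.
(* Using [cB] and [cC], each of [#|A1|], [#|A2|], [#|B1|] and [#|C1|] is counted in exactly three of
   the four cliques. *)
rewrite !cardU // (card_split3 _ _ _ _ splitX) (card_split3 _ _ _ _ splitY).
by rewrite bE; lia.
Qed.

End Cobipartite.

Theorem theorem3 (T : finType) (e : rel T)
    (e_sym : symmetric e) (e_irr : irreflexive e) (e_cobip : cobipartite e) :
  ((b_chromatic e)%:R <= 4 * (omega e)%:R / 3 :> rat)%R /\
  (forall b : nat, 0 < b -> (b_colorable e b <-> family_A b e)).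
Proof.
split=> [|b _]; last first.
  by split; [apply: b_colorable_family_A | apply: family_A_b_colorable].
have : 3 * b_chromatic e <= 4 * omega e.
  (* The bound holds for [0], passes to maxima, and holds for every attained [b] through the
     structure. *)
  rewrite /b_chromatic; elim/big_ind: _ => [|m n|b].
  - by rewrite muln0.
  - by rewrite maxnMr geq_max => -> ->.
  by move=> b_col; apply: family_A_omega => //; apply: b_colorable_family_A.
rewrite -(Num.Theory.ler_nat rat) !GRing.natrM; lra.
Qed.
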